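(* Let $\omega$ be a Delone set in $\mathbb{R}^d$ with repetitivity function $F:[1,\infty)\to[1,\infty)$. Then there exists some $\kappa>0$ with $\operatorname{card}(p_\omega(D))\le\kappa\,|B_{F(D)}|$ for all $D\ge 1$. Thus, $h_{\rm pc}(\omega)=0$ whenever $F(D)=o(\exp(D))$ (as $D\to\infty$). In particular, $h_{\rm pc}(\omega)=0$ when $\omega$ is linearly repetitive.
   Context: $B_S(x)$ is the closed Euclidean ball of radius $S$ around $x\in\mathbb{R}^d$, $B_S=B_S(0)$, and $|\cdot|$ is Lebesgue volume. Delone sets: a subset $\omega\subset\mathbb{R}^d$ is a Delone set if there are $0<r\le R$ such that every open ball of radius $r$ contains at most one point of $\omega$ and every closed ball of radius $R$ contains at least one point of $\omega$. Patches: for $D>0$, $p_\omega(D)=\{(-x+\omega)\cap B_D : x\in\omega\}$ is the set of $D$-patches of $\omega$. Patch counting entropy: $h_{\rm pc}(\omega)=\limsup_{n\to\infty}\frac{1}{|B_n|}\log\bigl(\operatorname{card}(p_\omega(n))\bigr)$. Repetitivity: $\omega$ has repetitivity function $F:[1,\infty)\to[1,\infty)$ if for every $D\ge1$ and every $x\in\omega$ one has $p_\omega(D)\subset\{(\omega-y)\cap B_D : y\in\omega\cap B_{F(D)}(x)\}$. If $F$ can be chosen as $F(D)=cD$ for some $c>1$, then $\omega$ is called linearly repetitive.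
   Formalization: The claim that h_pc(ω)=0 whenever F(D)=o(exp(D)) is stated only for d ≥ 2: for d = 1 it is false (gap sequences with positive entropy and exponential recurrence). The bound on card(p_ω(D)) and the linearly repetitive case are stated for all d ≥ 1. *)

(* Defs.v *)
From HB Require Import structures.
From mathcomp Require Import all_boot all_order all_algebra.
From mathcomp Require Import all_classical all_reals all_analysis.

Set Implicit Arguments.
Unset Strict Implicit.
Unset Printing Implicit Defensive.

Import Order.TTheory GRing.Theory Num.Theory.
Import numFieldNormedType.Exports.

Local Open Scope classical_set_scope.
Local Open Scope ring_scope.

(* The canonical norm (and [closed_ball]) of 'rV[R]_d is the sup norm, so the
   Euclidean norm and balls are introduced explicitly. *)
Definition enorm (R : realType) (d : nat) (x : 'rV[R]_d) : R :=
  Num.sqrt (\sum_(i < d) x 0 i ^+ 2).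

Definition eball (R : realType) (d : nat) (x : 'rV[R]_d) (S : R) :
    set 'rV[R]_d :=
  [set y | enorm (y - x) < S].

Definition ecball (R : realType) (d : nat) (x : 'rV[R]_d) (S : R) :
    set 'rV[R]_d :=
  [set y | enorm (y - x) <= S].

Section lebesgue_tuple.
Context {R : realType}.
Local Notation mR := (measurableTypeR R).

Definition cons_prod (n : nat) (p : mR * n.-tuple mR) : n.+1.-tuple mR :=
  [tuple of p.1 :: p.2].

Lemma measurable_cons_prod (n : nat) :
  measurable_fun [set: mR * n.-tuple mR] (@cons_prod n).
Proof. exact: measurable_cons. Qed.

Section step.
Variables (n : nat) (m : {sigma_finite_measure set (n.-tuple mR) -> \bar R}).

Definition leb_step : set (n.+1.-tuple mR) -> \bar R :=
  pushforward (@lebesgue_measure R \x m)%E (@cons_prod n).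

HB.instance Definition _ := Measure.copy leb_step
  (measure_function_pushforward__canonical__measure_function_Measure
     (@lebesgue_measure R \x m)%E (@measurable_cons_prod n)).

Let leb_step_sigma_finite : sigma_finite setT leb_step.
Proof.
have /sigma_finiteP[F [FT Fnd Ffin]] := sigma_finiteT (@lebesgue_measure R).
have /sigma_finiteP[G [GT Gnd Gfin]] := sigma_finiteT m.
pose uncons (v : n.+1.-tuple mR) : mR * n.-tuple mR :=
  (tnth v ord0, [tuple of behead v]).
have consK : cancel (@cons_prod n) uncons.
  by case=> x t; rewrite /uncons tnth0; congr pair; apply/val_inj.
have muncons : measurable_fun [set: n.+1.-tuple mR] uncons.
  apply/measurable_fun_pairP; split.
    exact: measurable_tnth.
  exact: measurable_behead.
exists (fun i => uncons @^-1` (F i `*` G i)).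
  apply/esym; rewrite -subTset => v _.
  have [i _ Fi] : (\bigcup_i F i) (uncons v).1 by rewrite -FT.
  have [j _ Gj] : (\bigcup_i G i) (uncons v).2 by rewrite -GT.
  exists (maxn i j) => //; split.
    by move: Fi; exact/subsetPset/Fnd/leq_maxl.
  by move: Gj; exact/subsetPset/Gnd/leq_maxr.
move=> i; have [mF finF] := Ffin i; have [mG finG] := Gfin i; split.
  by rewrite -[X in measurable X]setTI; apply: muncons => //; exact: measurableX.
rewrite /leb_step /pushforward -comp_preimage.
rewrite (_ : uncons \o _ = id); last by apply/funext => p /=; exact: consK.
by rewrite preimage_id product_measure1E// lte_mul_pinfty// ge0_fin_numE.
Qed.

HB.instance Definition _ :=
  Measure_isSigmaFinite.Build _ _ _ leb_step leb_step_sigma_finite.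
End step.

(* [leb n] is the n-fold product of the Lebesgue measure of [R] *)
Fixpoint leb (n : nat) : {sigma_finite_measure set (n.-tuple mR) -> \bar R} :=
  if n is n'.+1 then leb_step (leb n') else dirac ([tuple] : 0.-tuple mR).
End lebesgue_tuple.

(* 'rV[R]_d has no measurable structure in the library, so volumes are measured
   through the coordinate bijection with d-tuples. *)
Definition volume (R : realType) (d : nat) (A : set 'rV[R]_d) : \bar R :=
  @leb R d [set t | A (\row_i tnth t i)].

Definition is_delone (R : realType) (d : nat) (omega : set 'rV[R]_d) : Prop :=
  exists r S : R, [/\ 0 < r, r <= S,
    forall x y z, (omega `&` eball x r) y -> (omega `&` eball x r) z -> y = z &
    forall x, omega `&` ecball x S !=set0].

Definition patch (R : realType) (d : nat) (omega : set 'rV[R]_d) (D : R)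
    (x : 'rV[R]_d) : set 'rV[R]_d :=
  [set - x + y | y in omega] `&` ecball 0 D.

Definition patches (R : realType) (d : nat) (omega : set 'rV[R]_d) (D : R) :
    set (set 'rV[R]_d) :=
  [set patch omega D x | x in omega].

(* The term n = 0 divides by |B_0| = 0 for 0 < d; it does not affect the
   limsup. *)
Definition pc_entropy (R : realType) (d : nat) (omega : set 'rV[R]_d) : \bar R :=
  limn_esup (fun n : nat =>
    (lne (counting (patches omega n%:R)) / volume (@ecball R d 0 n%:R))%E).

(* A function [1, oo) -> [1, oo) is encoded as F : R -> R whose values below 1
   are irrelevant. *)
Definition is_repetitivity_fun (R : realType) (d : nat) (omega : set 'rV[R]_d)
    (F : R -> R) : Prop :=
  (forall D, 1 <= D -> 1 <= F D) /\
  (forall D x, 1 <= D -> omega x ->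
     patches omega D `<=`
       [set patch omega D y | y in omega `&` ecball x (F D)]).

Definition linearly_repetitive (R : realType) (d : nat)
    (omega : set 'rV[R]_d) : Prop :=
  exists2 c : R, 1 < c & is_repetitivity_fun omega (fun D => c * D).

(* Main.v *)
Require Import Defs.
From mathcomp Require Import all_boot all_order all_algebra.
From mathcomp Require Import all_classical all_reals all_analysis.
From mathcomp Require Import ring lra.

Import Order.TTheory GRing.Theory Num.Theory.
Import numFieldNormedType.Exports.

Local Open Scope classical_set_scope.
Local Open Scope ring_scope.

(* Repetitivity realizes every D-patch at a point of omega within F D of a fixed
   point x of omega.  Cutting the cube of half-width F D around x into cells of
   side r / (2d), each cell contains at most one point of omega, which gives
   O((F D)^d) patches, while |B_(F D)| is at least the volume of an inscribed
   cube of side F D / d.  Hence log card(p(n)) <= d log (F n) + O(1), and the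
   entropy vanishes as soon as log (F n) = o(n^d); F = o(exp) only yields
   log (F n) <= n, whence the restriction 1 < d. *)

(** * Euclidean norm and volume of balls, compared with cubes *)

(** The [d] squares sum to at most [S ^+ 2 / d]. The bound [S / d] is cruder than [S / sqrt d] but
    keeps roots out of all later constants. *)
Lemma enorm_le_bound (R : realType) (d : nat) (x : 'rV[R]_d) (S : R) :
  0 <= S -> (forall i, `|x 0 i| <= S / d%:R) -> enorm x <= S.
Proof.
case: d x => [|d] x S0 xS.
  by rewrite /enorm big_ord0 sqrtr0.
rewrite /enorm -(ger0_norm S0) -sqrtr_sqr; apply: ler_wsqrtr.
apply: (@le_trans _ _ (\sum_(i < d.+1) (S / d.+1%:R) ^+ 2)).
  apply: ler_sum => i _; rewrite -[X in X <= _]real_normK ?num_real//.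
  by rewrite lerXn2r ?nnegrE ?divr_ge0.
rewrite sumr_const card_ord -[leLHS]mulr_natr expr_div_n -mulrA ler_piMr ?sqr_ge0//.
rewrite -exprVn expr2 -mulrA mulVf ?mulr1 ?pnatr_eq0//.
by rewrite invf_le1 ?ltr0n// ler1n.
Qed.

Lemma coord_le_enorm (R : realType) (d : nat) (x : 'rV[R]_d) (i : 'I_d) :
  `|x 0 i| <= enorm x.
Proof.
rewrite /enorm -sqrtr_sqr; apply: ler_wsqrtr.
by rewrite (bigD1 i)//= lerDl sumr_ge0// => j _; exact: sqr_ge0.
Qed.

Lemma measurable_box (R : realType) (n : nat) (a : R) :
  measurable [set t : n.-tuple (measurableTypeR R) |
    forall i, 0 <= tnth t i <= a].
Proof.
rewrite (_ : [set _ | _] = \bigcap_(i in [set: 'I_n])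
  ((fun t : n.-tuple (measurableTypeR R) => tnth t i) @^-1` `[0, a])).
  apply: fin_bigcap_measurable => // i _.
  by rewrite -[X in measurable X]setTI; apply: measurable_tnth.
by apply/seteqP; split=> t /= h i; [move=> _ /=|]; rewrite ?in_itv/=; exact: h.
Qed.

Lemma leb_box (R : realType) (n : nat) (a : R) : 0 <= a ->
  @leb R n [set t | forall i, 0 <= tnth t i <= a] = (a ^+ n)%:E.
Proof.
move=> a0; elim: n => [|n IH].
  by rewrite /= diracE mem_set// => -[].
rewrite [LHS]/(leb_step _ _) /leb_step /pushforward.
rewrite (_ : _ @^-1` _ =
    `[0, a] `*` [set t : n.-tuple _ | forall i, 0 <= tnth t i <= a]).
  rewrite product_measure1E//; last exact: measurable_box.
  have lebE : lebesgue_measure (`[0, a] : set R) = a%:E.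
    rewrite lebesgue_measure_itv /= lte_fin.
    (* If [0 < a] fails then [a = 0], and the default value 0 of the interval formula is still
       right. *)
    by case: ltP => [_|a_le0]; rewrite ?sube0//; congr EFin; apply/le_anti/andP.
  by rewrite IH [X in (X * _)%E]lebE -EFinM exprS.
apply/seteqP; split=> [[x t] h|[x t] [/= xa h] i].
  split => /= [|i]; rewrite ?in_itv/=; first by have := h ord0; rewrite tnth0.
  by have := h (lift ord0 i); rewrite tnthS.
case: (unliftP ord0 i) => [j|] ->; rewrite ?tnthS ?tnth0//.
Qed.

(** As [0 <= S], squaring turns the ball into a sublevel set of a polynomial in the coordinates. *)
Lemma measurable_ecball (R : realType) (d : nat) (S : R) : 0 <= S ->
  measurable [set t : d.-tuple (measurableTypeR R) |
    ecball 0 S (\row_i tnth t i)].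
Proof.
move=> S0.
rewrite (_ : [set _ | _] = [set: d.-tuple (measurableTypeR R)] `&`
    [set t | \sum_(i < d) tnth t i ^+ 2 <= S ^+ 2]).
  apply: measurable_fun_le => //.
  apply: measurable_sum => i; apply: measurable_realfun.measurable_funX.
  exact: measurable_tnth.
rewrite setTI; apply/seteqP; split=> t; rewrite /ecball /= subr0.
  rewrite /enorm (eq_bigr (fun i => tnth t i ^+ 2)) => [|i _]; last by rewrite mxE.
  rewrite -(ler_pXn2r (n := 2)) ?nnegrE ?sqrtr_ge0// sqr_sqrtr//.
  by apply: sumr_ge0 => i _; exact: sqr_ge0.
move=> h; rewrite /enorm (eq_bigr (fun i => tnth t i ^+ 2)) => [|i _].
  by rewrite -(ger0_norm S0) -sqrtr_sqr; exact: ler_wsqrtr.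
by rewrite mxE.
Qed.

(** The cube [[0, S / d]^d], with a corner at the centre, lies in the ball. *)
Lemma volume_ecball_ge (R : realType) (d : nat) (S : R) : 0 <= S ->
  (((S / d%:R) ^+ d)%:E <= volume (@ecball R d 0 S))%E.
Proof.
move=> S0; rewrite -leb_box ?divr_ge0//; apply: le_measure.
- by rewrite inE; exact: measurable_box.
- by rewrite inE; exact: measurable_ecball.
- move=> t h; rewrite /= /ecball /= subr0; apply: enorm_le_bound => // i.
  by rewrite mxE; have /andP[t0] := h i; rewrite ger0_norm.
Qed.

(** * Counting patches by cells *)

Lemma counting_ge1 (R : realType) (T : choiceType) (A : set T) :
  A !=set0 -> (1 <= counting A :> \bar R)%E.
Proof.
move=> [x Ax]; rewrite /counting; case: ifPn => [/asboolP fA|_]; last exact: leey.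
rewrite lee_fin ler1n finmap.cardfs_gt0.
by apply/finmap.fset0Pn; exists x; rewrite in_fset_set// inE.
Qed.

Lemma counting_le_card (R : realType) (T : choiceType) (I : finType)
    (A : set T) (g : I -> T) :
  A `<=` range g -> (counting A <= (#|I|%:R : R)%:E)%E.
Proof.
move=> Ag; have fA : finite_set A.
  by apply: sub_finite_set Ag _; exact/finite_image/finite_finset.
rewrite /counting asboolT// lee_fin ler_nat -(size_codom g).
apply: uniq_leq_size => [|x]; first exact: finmap.fset_uniq.
by rewrite in_fset_set// inE => /Ag[t _ <-]; exact: codom_f.
Qed.

Lemma counting_patches_le (R : realType) (d : nat) (omega : set 'rV[R]_d)
    (r S D : R) (x : 'rV[R]_d) : (0 < d)%N -> 0 < r -> 0 <= S ->
  (forall x y z, (omega `&` eball x r) y -> (omega `&` eball x r) z -> y = z) ->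
  patches omega D `<=` [set Defs.patch omega D y | y in omega `&` ecball x S] ->
  (counting (patches omega D)
     <= ((Num.truncn (2 * S * d%:R / (r / 2))).+1 ^ d)%:R%:E :> \bar R)%E.
Proof.
move=> d0 r0 S0 sep rep; set N := Num.truncn _.
have d0R : 0 < d%:R :> R by rewrite ltr0n.
have r2 : 0 < r / 2 by rewrite divr_gt0.
(* Cell number of [y] along axis [i], counted from the face [x 0 i - S] in steps of [r / 2 / d]; on
   the ball it ranges over 0, ..., [N]. *)
pose k (y : 'rV[R]_d) (i : 'I_d) := Num.truncn ((y 0 i - x 0 i + S) * d%:R / (r / 2)).
pose idx (y : 'rV[R]_d) : {ffun 'I_d -> 'I_N.+1} := [ffun i => inord (k y i)].
have cell y i : ecball x S y ->
    0 <= (y 0 i - x 0 i + S) * d%:R / (r / 2) <= 2 * S * d%:R / (r / 2).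
  move=> yS; have := le_trans (coord_le_enorm _ _ (y - x) i) yS.
  rewrite !mxE ler_norml => /andP[lo hi].
  have yx : 0 <= y 0 i - x 0 i + S by rewrite -lerBlDr sub0r.
  apply/andP; split; first by apply: divr_ge0; [exact: mulr_ge0|exact: ltW].
  apply: ler_wpM2r; first by rewrite invr_ge0 ltW.
  by apply: ler_wpM2r; rewrite ?ler0n// mulr_natl mulr2n lerD2r.
have idxE y i : ecball x S y -> idx y i = k y i :> nat.
  move=> yS; rewrite ffunE inordK// ltnS; have /andP[_] := cell y i yS.
  exact: le_truncn.
have idx_inj y z : (omega `&` ecball x S) y -> (omega `&` ecball x S) z ->
    idx y = idx z -> y = z.
  (* Separation is applied to the ball centred at [y]: coordinates in a common cell differ by at
     most [r / 2 / d], so the points are within [r / 2 < r]. *)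
  move=> [oy yS] [oz zS] yz; apply: (sep y); split => //.
    by rewrite /eball /= subrr /enorm big1 ?sqrtr0// => i _; rewrite mxE expr0n.
  rewrite /eball /=; apply: (@le_lt_trans _ _ (r / 2)); last first.
    by rewrite ltr_pdivrMr// ltr_pMr// ltr1n.
  apply: enorm_le_bound => [|i]; first exact: ltW.
  have : k y i = k z i by rewrite -!idxE// yz.
  have /andP[y0 _] := cell y i yS; have /andP[z0 _] := cell z i zS.
  have := truncn_itv z0; have := truncn_itv y0; rewrite -/(k y i) -/(k z i) => + + kE.
  rewrite kE ler_pdivlMr// ltr_pdivrMr// => /andP[yl yu].
  rewrite ler_pdivlMr// ltr_pdivrMr// => /andP[zl zu].
  rewrite !mxE ler_pdivlMr// -[d%:R]gtr0_norm// -normrM ler_norml.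
  by move: yl yu zl zu; rewrite -natr1; lra.
(* Each cell is sent to the patch at its only point; an empty cell gets the patch at the default 0,
   which merely enlarges the range. *)
apply: le_trans (counting_le_card _ _ _ _
  (fun t => Defs.patch omega D (xget 0 [set y | (omega `&` ecball x S) y /\ idx y = t]))
  _) _.
  move=> p /rep[y oy <-]; exists (idx y) => //.
  have /= [oz zy] := xgetPex 0 (ex_intro (fun z => (omega `&` ecball x S) z /\
    idx z = idx y) y (conj oy erefl)).
  by congr Defs.patch; exact: idx_inj.
by rewrite card_ffun !card_ord.
Qed.

Lemma delone_nonempty (R : realType) (d : nat) (omega : set 'rV[R]_d) :
  is_delone omega -> omega !=set0.
Proof. by move=> [r [S [_ _ _ /(_ 0)[x [ox _]]]]]; exists x. Qed.

Lemma counting_patches_le_powF (R : realType) (d : nat) (omega : set 'rV[R]_d) :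
  (0 < d)%N -> is_delone omega ->
  exists2 K : R, 0 < K & forall F D, is_repetitivity_fun omega F -> 1 <= D ->
    (counting (patches omega D) <= (K * F D ^+ d)%:E)%E.
Proof.
move=> d0 dl; have [x ox] := delone_nonempty _ _ _ dl.
move: dl => [r [_ [r0 _ sep _]]].
have r2 : 0 < r / 2 by rewrite divr_gt0.
have c0 : 0 <= 2 * d%:R / (r / 2) by rewrite divr_ge0 ?mulr_ge0// ltW.
exists ((2 * d%:R / (r / 2) + 1) ^+ d) => [|F D [F1 rep] D1].
  by rewrite exprn_gt0// ltr_wpDl.
have FD1 := F1 _ D1; have FD0 : 0 <= F D by exact: le_trans FD1.
apply: le_trans (counting_patches_le _ _ _ _ _ _ _ d0 r0 FD0 sep (rep _ _ D1 ox)) _.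
rewrite lee_fin natrX -exprMn lerXn2r ?nnegrE ?mulr_ge0 ?addr_ge0//.
(* The extra cell per axis is absorbed by [1 <= F D]. *)
rewrite -natr1 [leRHS]mulrDl mul1r. apply: lerD => //.
rewrite [leRHS](_ : _ = 2 * F D * d%:R / (r / 2)); last first.
  by ring.
by rewrite truncn_le divr_ge0 ?mulr_ge0// ltW.
Qed.

Lemma patches_volume_bound (R : realType) (d : nat) (omega : set 'rV[R]_d)
    (F : R -> R) :
  (0 < d)%N -> is_delone omega -> is_repetitivity_fun omega F ->
  exists2 kappa : R, 0 < kappa & forall D : R, 1 <= D ->
    (counting (patches omega D) <= kappa%:E * volume (@ecball R d 0 (F D)))%E.
Proof.
move=> d0 dl rep; have [K K0 KF] := counting_patches_le_powF _ _ _ d0 dl.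
have dR0 : 0 < d%:R :> R by rewrite ltr0n.
(* The factor [d ^+ d] compensates for the side [F D / d] of the inscribed cube. *)
exists (K * d%:R ^+ d) => [|D D1]; first by rewrite mulr_gt0// exprn_gt0.
have FD0 : 0 <= F D by exact: le_trans (rep.1 _ D1).
apply: le_trans (KF _ _ rep D1) _.
have Fd : (K * F D ^+ d) = K * d%:R ^+ d * (F D / d%:R) ^+ d.
  by rewrite -mulrA -exprMn mulrC [_ * (F D / _)]mulrC divfK ?gt_eqF// mulrC.
rewrite Fd EFinM; apply: lee_wpmul2l; last exact: volume_ecball_ge.
by rewrite lee_fin mulr_ge0 ?exprn_ge0// ltW.
Qed.

(** * Vanishing of the entropy *)

Lemma near_natr_ge (R : realType) (A : R) : \forall n \near \oo, A <= n%:R.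
Proof. by have /cvgryPge := @cvgr_idn R; apply. Qed.

(** The growth hypothesis says [ln (F n) = o(n ^+ d)], with a slack [C] that the denominator
    swallows. The quotients are squeezed between 0 and a null sequence. *)
Lemma pc_entropy_eq0 (R : realType) (d : nat) (omega : set 'rV[R]_d)
    (F : R -> R) :
  (0 < d)%N -> is_delone omega -> is_repetitivity_fun omega F ->
  (forall e : R, 0 < e -> exists C : R,
     \forall n \near \oo, ln (F n%:R) <= e * n%:R ^+ d + C) ->
  pc_entropy omega = 0%E.
Proof.
move=> d0 dl rep subvol; have [K K0 KF] := counting_patches_le_powF _ _ _ d0 dl.
have dR0 : 0 < d%:R :> R by rewrite ltr0n.
(* The logarithm of the patch bound [K * F n ^+ d], over the volume of the inscribed cube. *)
pose v (n : nat) : R := (ln K + d%:R * ln (F n%:R)) / (n%:R / d%:R) ^+ d.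
rewrite /pc_entropy; set u := (X in limn_esup X).
suff : u @ \oo --> 0%E by move/cvg_limn_einf_sup => [].
have patches1 (D : R) : (1 <= counting (patches omega D) :> \bar R)%E.
  apply: counting_ge1; have [x ox] := delone_nonempty _ _ _ dl.
  by exists (Defs.patch omega D x); exists x.
have bnd (n : nat) : (0 < n)%N ->
    (0 <= lne (counting (patches omega n%:R)) / volume (@ecball R d 0 n%:R)
       <= (v n)%:E)%E.
  move=> n0; have n1 : 1 <= n%:R :> R by rewrite ler1n.
  have Fn0 : 0 < F n%:R by exact: lt_le_trans (rep.1 _ n1).
  have nd0 : 0 < (n%:R / d%:R : R) ^+ d by rewrite exprn_gt0// divr_gt0// ltr0n.
  have vol0 : (0 <= volume (@ecball R d 0 n%:R))%E.
    by apply: le_trans (volume_ecball_ge _ _ _ _) => //; rewrite lee_fin ltW.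
  have ln0 : (0 <= lne (counting (patches omega n%:R)) :> \bar R)%E.
    by rewrite lne_ge0.
  apply/andP; split; first by rewrite mule_ge0 ?inve_ge0.
  rewrite /v EFinM; apply: lee_pmul => //; first by rewrite inve_ge0.
    have KFn := KF _ _ rep n1; have KFn0 : 0 < K * F n%:R ^+ d.
      by rewrite mulr_gt0// exprn_gt0.
    rewrite mulr_natl -lnXn// -lnM ?posrE ?exprn_gt0// -lne_EFin//.
    rewrite lee_lne// in_itv/= leey andbT; last by rewrite lee_fin ltW.
    exact: le_trans (patches1 _).
  rewrite (_ : (_^-1)%:E = (((n%:R / d%:R) ^+ d)%:E)^-1%E); last by rewrite inver gt_eqF.
  by rewrite lee_pV2 ?inE//; exact: volume_ecball_ge.
apply: (@squeeze_cvge _ _ _ _ (cst 0%E) _ (EFin \o v)).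
- by near=> n; apply: bnd; near: n; exact: nbhs_infty_gt.
- exact: cvg_cst.
apply: cvg_EFin; first by near=> n.
apply/cvgr0Pnorm_le => e e0.
have dd0 : 0 < d%:R ^+ d :> R by rewrite exprn_gt0.
(* One [q] pays for [d * ln (F n)], the other for the constants; [d ^+ d] cancels the denominator of
   [(n / d) ^+ d]. *)
have [q q0 eE] : exists2 q, 0 < q & e = (q + q) * d%:R ^+ d.
  by exists (e / d%:R ^+ d / 2); rewrite ?divr_gt0// -splitr divfK ?gt_eqF.
have [C FC] := subvol (q / d%:R) (divr_gt0 q0 dR0).
near=> n.
have n0 : (0 < n)%N by near: n; exact: nbhs_infty_gt.
have n1 : 1 <= n%:R :> R by rewrite ler1n.
have /andP[tn0 tnv] := bnd n n0.
rewrite ger0_norm; last by rewrite -lee_fin; exact: le_trans tnv.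
rewrite /v ler_pdivrMr ?exprn_gt0 ?divr_gt0 ?ltr0n//.
have -> : e * (n%:R / d%:R) ^+ d = q * n%:R ^+ d + q * n%:R ^+ d.
  by rewrite eE expr_div_n -mulrDl -mulrA [_ * (_ / _)]mulrC divfK ?gt_eqF.
have lnF : d%:R * ln (F n%:R) <= q * n%:R ^+ d + d%:R * C.
  have -> : q * n%:R ^+ d + d%:R * C = d%:R * (q / d%:R * n%:R ^+ d + C).
    by rewrite mulrDr !mulrA [d%:R * q]mulrC mulfK ?gt_eqF.
  by apply: ler_wpM2l; [rewrite ler0n|near: n].
(* A constant is eventually below [q * n], and [n <= n ^+ d] since [0 < d]. *)
have nq : ln K + d%:R * C <= q * n%:R ^+ d.
  apply: (@le_trans _ _ (q * n%:R)); last first.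
    by apply: ler_wpM2l; [exact: ltW|rewrite -[leLHS]expr1 ler_weXn2l].
  rewrite -ler_pdivrMl//; near: n.
  exact: near_natr_ge.
by lra.
Unshelve. all: by end_near.
Qed.

Lemma pc_entropy_eq0_subexp (R : realType) (d : nat) (omega : set 'rV[R]_d)
    (F : R -> R) :
  (1 < d)%N -> is_delone omega -> is_repetitivity_fun omega F ->
  F D / expR D @[D --> +oo] --> 0 -> pc_entropy omega = 0%E.
Proof.
move=> d1 dl rep Fexp; apply: (pc_entropy_eq0 _ _ _ F) => //; first exact: ltnW.
move=> e e0; exists 0; near=> n.
have n1 : 1 <= n%:R :> R by rewrite ler1n; near: n; exact: nbhs_infty_gt.
have Fn0 : 0 < F n%:R by exact: lt_le_trans (rep.1 _ n1).
rewrite addr0; apply: (@le_trans _ _ n%:R).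
  rewrite -[leRHS]expRK ler_ln ?posrE ?expR_gt0//.
  rewrite -[leRHS]mul1r -ler_pdivrMr ?expR_gt0//.
  apply: le_trans (ler_norm _) _; near: n.
  exact: (@cvgr_idn R _ (cvgr0_norm_le _ Fexp 1 ltr01)).
(* [n <= e * n ^+ 2] once [n >= 1 / e]; the exponent 2 is then raised to [d] by [1 < d]. *)
apply: (@le_trans _ _ (e * n%:R ^+ 2)).
  rewrite expr2 mulrA ler_peMl// mulrC -ler_pdivrMr// div1r; near: n.
  exact: near_natr_ge.
by apply: ler_wpM2l; [exact: ltW|exact: ler_weXn2l].
Unshelve. all: by end_near.
Qed.

(** Here [ln (F n)] grows logarithmically, hence is [o(n)], which suffices in dimension one as
    well. *)
Lemma pc_entropy_eq0_linear (R : realType) (d : nat) (omega : set 'rV[R]_d) :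
  (0 < d)%N -> is_delone omega -> linearly_repetitive omega ->
  pc_entropy omega = 0%E.
Proof.
move=> d0 dl [c c1 rep]; apply: (pc_entropy_eq0 _ _ _ (fun D => c * D)) => //.
move=> e e0; have c0 : 0 < c by exact: lt_trans c1.
(* ln (c n) = ln (e n) + ln (c / e) <= e n + ln (c / e) *)
exists (ln (c / e)); near=> n.
have n1 : 1 <= n%:R :> R by rewrite ler1n; near: n; exact: nbhs_infty_gt.
have n0 : 0 < n%:R :> R by exact: lt_le_trans n1.
have -> : c * n%:R = e * n%:R * (c / e).
  by rewrite [e * _]mulrC -mulrA [e * (c / e)]mulrC divfK ?gt_eqF// mulrC.
rewrite lnM ?posrE ?mulr_gt0 ?invr_gt0// lerD2r.
apply: le_trans (ltW (ln_sublinear _)) _; first exact: mulr_gt0.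
by apply: ler_wpM2l; [exact: ltW|rewrite -[leLHS]expr1 ler_weXn2l].
Unshelve. all: by end_near.
Qed.

Theorem theorem7 (R : realType) (d : nat) (hd : (0 < d)%N)
    (omega : set 'rV[R]_d) (homega : is_delone omega) :
  (forall F : R -> R, is_repetitivity_fun omega F ->
     (exists2 kappa : R, 0 < kappa &
        forall D : R, 1 <= D ->
          (counting (patches omega D)
             <= kappa%:E * volume (@ecball R d 0%R (F D)))%E) /\
     ((1 < d)%N -> (fun D : R => F D / expR D) @ +oo --> (0 : R) -> pc_entropy omega = 0%E)) /\
  (linearly_repetitive omega -> pc_entropy omega = 0%E).
Proof.
split => [F rep|]; last exact: pc_entropy_eq0_linear.
split; first exact: patches_volume_bound.
by move=> d1; exact: pc_entropy_eq0_subexp.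
Qed.
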